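(* Let $\widehat\sigma,\sigma,\widetilde\sigma\subset\mathbb R^3$ be three $C^1$-surfaces, possibly with boundary. Let $\sigma$ and $\widetilde\sigma$ be parametrized by $\boldsymbol Y:\widehat\sigma\to\mathbb R^3$ and $\widetilde{\boldsymbol Y}=\boldsymbol X\circ\boldsymbol Y:\widehat\sigma\to\mathbb R^3$, respectively, where $\boldsymbol X\in C^1(\sigma,\mathbb R^3)$. Then everywhere in $\widehat\sigma$ $$\big[\nabla_\sigma\boldsymbol X:\nabla_\sigma(\boldsymbol X-\mathrm{id})\big]\circ\boldsymbol Y\;|\mathcal J(\boldsymbol Y)|\ \ge\ |\mathcal J(\widetilde{\boldsymbol Y})|-|\mathcal J(\boldsymbol Y)|,$$ with equality if $\boldsymbol X=\mathrm{id}\in C^1(\sigma,\mathbb R^3)$.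
   Context: The parametrizations are $C^1$ maps. $\nabla_\sigma$ is the surface gradient on $\sigma$: with $\{\boldsymbol\tau_1,\boldsymbol\tau_2\}$ a local orthonormal basis of the tangent space of $\sigma$, $\nabla_\sigma\boldsymbol X=\sum_{k=1}^2\partial_{\boldsymbol\tau_k}\boldsymbol X\otimes\boldsymbol\tau_k$. The symbol $:$ is the Frobenius inner product and $\mathrm{id}$ the identity on $\sigma$. The surface elements $|\mathcal J(\boldsymbol Y)|$ and $|\mathcal J(\widetilde{\boldsymbol Y})|$ of $\sigma$ and $\widetilde\sigma$ are the Euclidean norms of $\mathcal J(\boldsymbol Y)=\partial_{\widehat{\boldsymbol\tau}_1}\boldsymbol Y\times\partial_{\widehat{\boldsymbol\tau}_2}\boldsymbol Y$ and $\mathcal J(\widetilde{\boldsymbol Y})=\partial_{\widehat{\boldsymbol\tau}_1}\widetilde{\boldsymbol Y}\times\partial_{\widehat{\boldsymbol\tau}_2}\widetilde{\boldsymbol Y}$, where $\{\widehat{\boldsymbol\tau}_1,\widehat{\boldsymbol\tau}_2\}$ is an orthonormal basis of the tangent space of $\widehat\sigma$. *)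

(* Defs.v *)
From mathcomp Require Import all_boot all_order all_algebra.
From mathcomp Require Import all_classical all_reals all_analysis.
Set Implicit Arguments.
Unset Strict Implicit.
Unset Printing Implicit Defensive.
Import Order.TTheory GRing.Theory Num.Theory.
Import numFieldNormedType.Exports.
Local Open Scope classical_set_scope.
Local Open Scope ring_scope.

(* Points and vectors of R^n are row vectors. The library's norm on 'rV[R]_n is
   the sup norm; it is used only for the topology and differentiability. *)

Definition dotr (R : realType) (n : nat) (a b : 'rV[R]_n) : R :=
  \sum_(i < n) a 0 i * b 0 i.

Definition enorm (R : realType) (n : nat) (a : 'rV[R]_n) : R :=
  Num.sqrt (dotr a a).

Definition cross (R : realType) (a b : 'rV[R]_3) : 'rV[R]_3 :=
  \row_(i < 3) (a 0 (i + 1) * b 0 (i + 2%:R) - a 0 (i + 2%:R) * b 0 (i + 1)).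

Definition outer (R : realType) (n : nat) (a b : 'rV[R]_n) : 'M[R]_n :=
  \matrix_(i < n, j < n) (a 0 i * b 0 j).

Definition frob (R : realType) (n : nat) (A B : 'M[R]_n) : R :=
  \sum_(i < n) \sum_(j < n) A i j * B i j.

(* A map on a subset A of R^m is represented by a total function f of which
   only the values on A matter: as usual for sets that need not be open, f is
   C^1 on A when it coincides locally on A with C^1 maps defined on open
   neighbourhoods in R^m. *)

Definition C1_near (R : realType) (m n : nat)
    (F : 'rV[R]_m -> 'rV[R]_n) (p : 'rV[R]_m) : Prop :=
  \forall x \near p, differentiable F x /\ {for x, continuous (jacobian F)}.

Definition C1_extension (R : realType) (m n : nat) (A : set 'rV[R]_m)
    (f : 'rV[R]_m -> 'rV[R]_n) (p : 'rV[R]_m) (F : 'rV[R]_m -> 'rV[R]_n) : Prop :=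
  C1_near F p /\ \forall x \near p, A x -> F x = f x.

Definition C1_on (R : realType) (m n : nat) (A : set 'rV[R]_m)
    (f : 'rV[R]_m -> 'rV[R]_n) : Prop :=
  forall p, A p -> exists F, C1_extension A f p F.

(* Derivative at p, in the direction v, of the map f defined on A. For A a
   relatively open part of the half-plane, or A a surface and v tangent to A
   at p, the value does not depend on the chosen C^1 extension, also at
   boundary points. *)
Definition dder (R : realType) (m n : nat) (A : set 'rV[R]_m)
    (f : 'rV[R]_m -> 'rV[R]_n) (p v : 'rV[R]_m) : 'rV[R]_n :=
  'D_v (get [set F | C1_extension A f p F]) p.

Definition half_plane (R : realType) : set 'rV[R]_2 := [set u | 0 <= u 0 1].
Arguments half_plane : clear implicits.

(* phi parametrizes the part of S inside the open set W by the relatively open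
   part V `&` half_plane R of the half-plane; it is a C^1 diffeomorphism with
   inverse psi. When V does not meet the boundary line this is an interior
   chart. *)
Record is_chart (R : realType) (S : set 'rV[R]_3) (V : set 'rV[R]_2)
    (W : set 'rV[R]_3) (phi : 'rV[R]_2 -> 'rV[R]_3)
    (psi : 'rV[R]_3 -> 'rV[R]_2) : Prop := IsChart {
  chart_open_dom : open V ;
  chart_open_img : open W ;
  chart_C1 : C1_on (V `&` half_plane R) phi ;
  chart_inv_C1 : C1_on (S `&` W) psi ;
  chart_img : phi @` (V `&` half_plane R) = S `&` W ;
  chart_cancel : forall u, (V `&` half_plane R) u -> psi (phi u) = u }.

Definition C1_surface (R : realType) (S : set 'rV[R]_3) : Prop :=
  forall p, S p -> exists V W phi psi, is_chart S V W phi psi /\ W p.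

(* At a boundary point this is the full tangent plane, not a half-plane. *)
Definition tangent (R : realType) (S : set 'rV[R]_3) (p : 'rV[R]_3) :
    set 'rV[R]_3 :=
  [set v | exists V W phi psi u w,
    [/\ is_chart S V W phi psi, (V `&` half_plane R) u, phi u = p
      & v = dder (V `&` half_plane R) phi u w]].

Definition onb_tangent (R : realType) (S : set 'rV[R]_3)
    (p t1 t2 : 'rV[R]_3) : Prop :=
  [/\ dotr t1 t1 = 1, dotr t2 t2 = 1, dotr t1 t2 = 0
    & tangent S p = [set v | exists a b : R, v = a *: t1 + b *: t2]].

Definition parametrizes (R : realType) (S0 S : set 'rV[R]_3)
    (Y : 'rV[R]_3 -> 'rV[R]_3) : Prop :=
  C1_on S0 Y /\ Y @` S0 = S.

Definition surf_grad (R : realType) (S : set 'rV[R]_3)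
    (X : 'rV[R]_3 -> 'rV[R]_3) (t1 t2 y : 'rV[R]_3) : 'M[R]_3 :=
  outer (dder S X y t1) t1 + outer (dder S X y t2) t2.

Definition surf_elt (R : realType) (S : set 'rV[R]_3)
    (Y : 'rV[R]_3 -> 'rV[R]_3) (t1 t2 p : 'rV[R]_3) : R :=
  enorm (cross (dder S Y p t1) (dder S Y p t2)).

(* Main.v *)
Require Import Defs.
From mathcomp Require Import all_boot all_order all_algebra.
From mathcomp Require Import all_classical all_reals all_analysis.
From mathcomp Require Import ring lra.
Import Order.TTheory GRing.Theory Num.Theory.
Import numFieldNormedType.Exports.
Local Open Scope classical_set_scope.
Local Open Scope ring_scope.
Set Implicit Arguments.
Unset Strict Implicit.
Unset Printing Implicit Defensive.

(** Let x1, x2 be the images of the orthonormal tangent vectors t1, t2 under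
    the differential of X. Orthonormality turns the Frobenius product into
    x1 . (x1 - t1) + x2 . (x2 - t2), and turns the two surface elements into
    |D| and |D| |x1 x x2|, where D is the determinant of the differential of Y
    in the bases s1, s2 and t1, t2. The factor |D| >= 0 being common to both
    sides, what remains is
      |x1 x x2| - 1 <= x1 . (x1 - t1) + x2 . (x2 - t2)    ([area_energy_le]),
    the sum of |x1 x x2| <= (|x1|^2 + |x2|^2) / 2 ([enorm_cross_le]), which is
    Lagrange's identity together with the mean inequality, and of
    (|x|^2 - 1) / 2 <= x . (x - t) for a unit vector t ([dotr_sub_ge]), which
    is |x - t|^2 >= 0. For X = id both sides of the claim are 0.

    This computation needs three facts on derivatives along a set, also at
    boundary points: they do not depend on the chosen extension
    ([dder_extension]), they obey the chain rule ([dder_comp]), and the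
    differential of Y maps tangent vectors of the first surface to tangent
    vectors of the second ([velocity_line_tangent] with [dder_velocity_line]).
    A tangent vector is, up to sign, the right derivative at 0 of a curve that
    stays in the set for small positive times. Two differentiable maps that
    agree on the set agree along such a curve, hence have the same derivative
    in that direction ([velocity_line_derive_eq]), which gives the first two
    facts; the image of the curve under Y gives the third, as a chart turns
    the velocity of a curve into a tangent vector. Since differentials are
    linear the sign is harmless, and interior and boundary points are treated
    alike. *)

(** * Velocities of curves entering a set *)

(** Being differentiable at 0 as a map on the whole line, the curve can be
    composed with differentiable maps although it is confined to [A] for
    positive times only. *)
Definition inward_velocity (R : realType) (n : nat) (A : set 'rV[R]_n)
    (p v : 'rV[R]_n) : Prop :=
  exists c : R -> 'rV[R]_n, [/\ differentiable c 0, c 0 = p, 'D_1 c 0 = v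
    & \forall h \near 0^'+, A (c h)].

(** Allowing both signs recovers the full tangent space at a boundary point
    of a surface, where only a half-plane consists of inward velocities. *)
Definition velocity_line (R : realType) (n : nat) (A : set 'rV[R]_n)
    (p v : 'rV[R]_n) : Prop :=
  inward_velocity A p v \/ inward_velocity A p (- v).

Lemma derive_right0 (R : realType) (V : normedModType R) (f : R -> V) :
  derivable f 0 1 -> f 0 = 0 -> (\forall h \near 0^'+, f h = 0) ->
  'D_1 f 0 = 0.
Proof.
move=> df f0 fh.
apply: (@cvg_unique _ _ ((fun h : R => h^-1 *: (f (h *: 1 + 0) - f 0)) @ 0^'+)).
- exact: norm_hausdorff.
- exact/cvg_dnbhs_at_right.
apply: cvg_near_cst; near=> h.
have -> : f (h *: 1 + 0) = 0 by rewrite addr0 [h *: 1]mulr1; near: h.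
by rewrite f0 subr0 scaler0.
Unshelve. all: by end_near. Qed.

Lemma derive_comp (R : realType) (m n : nat) (c : R -> 'rV[R]_m)
    (F : 'rV[R]_m -> 'rV[R]_n) :
  differentiable c 0 -> differentiable F (c 0) ->
  differentiable (F \o c) 0 /\ 'D_1 (F \o c) 0 = 'D_('D_1 c 0) F (c 0).
Proof.
move=> dc dF; have dFc : differentiable (F \o c) 0 by exact: differentiable_comp.
split=> //.
by rewrite (deriveE _ dFc) (diff_comp dc dF) (deriveE _ dF) (deriveE _ dc).
Qed.

Lemma near_curve (R : realType) (n : nat) (c : R -> 'rV[R]_n)
    (P : set 'rV[R]_n) :
  differentiable c 0 -> nbhs (c 0) P -> \forall h \near 0^'+, P (c h).
Proof.
move=> /differentiable_continuous cc cP.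
exact: (cvg_at_right_filter cc).
Qed.

Lemma near_diff_image (R : realType) (m n : nat) (F : 'rV[R]_m -> 'rV[R]_n)
    (P : set 'rV[R]_n) (p : 'rV[R]_m) :
  differentiable F p -> nbhs (F p) P -> \forall x \near p, P (F x).
Proof. by move=> /differentiable_continuous cF FP; exact: cF. Qed.

Lemma derive_oppr (R : realType) (m n : nat) (F : 'rV[R]_m -> 'rV[R]_n)
    (p v : 'rV[R]_m) :
  differentiable F p -> 'D_(- v) F p = - 'D_v F p.
Proof. by move=> dF; rewrite (deriveE _ dF) linearN (deriveE _ dF). Qed.

(** The difference of the two maps vanishes along the curve for small positive
    times, which forces its derivative at 0 to vanish; linearity of the
    differentials takes care of the opposite sign. *)
Lemma velocity_line_derive_eq (R : realType) (m n : nat) (A : set 'rV[R]_m)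
    (F G : 'rV[R]_m -> 'rV[R]_n) (p v : 'rV[R]_m) :
  differentiable F p -> differentiable G p -> A p ->
  (\forall x \near p, A x -> F x = G x) -> velocity_line A p v ->
  'D_v F p = 'D_v G p.
Proof.
move=> dF dG Ap FG.
have FGp : F p = G p by exact: (nbhs_singleton FG).
suff inw w : inward_velocity A p w -> 'D_w F p = 'D_w G p.
  case=> [|/inw]; first exact: inw.
  by rewrite (derive_oppr _ dF) (derive_oppr _ dG) => /oppr_inj.
case=> c [dc c0 <- Ac]; rewrite -c0 in dF dG FG FGp *.
have dFG : differentiable (F - G) (c 0) by exact: differentiableB.
have [dFGc DFGc] := derive_comp dc dFG.
have dwF e : derivable F (c 0) e by exact: diff_derivable.
have dwG e : derivable G (c 0) e by exact: diff_derivable.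
apply/eqP; rewrite -subr_eq0 -(deriveB (dwF _) (dwG _)) -DFGc; apply/eqP.
apply: derive_right0; first exact: diff_derivable.
  by rewrite /= -[(F - G) _]/(F (c 0) - G (c 0)) FGp subrr.
have FGc := near_curve dc FG.
near=> h; rewrite /= -[(F - G) _]/(F (c h) - G (c h)).
have Ach : A (c h) by near: h.
suff -> : F (c h) = G (c h) by rewrite subrr.
by move: Ach; near: h.
Unshelve. all: by end_near. Qed.

Lemma velocity_line_image (R : realType) (m n : nat) (A : set 'rV[R]_m)
    (B : set 'rV[R]_n) (F : 'rV[R]_m -> 'rV[R]_n) (p v : 'rV[R]_m) :
  differentiable F p -> (\forall x \near p, A x -> B (F x)) ->
  velocity_line A p v -> velocity_line B (F p) ('D_v F p).
Proof.
move=> dF FB.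
suff inw w : inward_velocity A p w ->
    inward_velocity B (F p) ('D_w F p).
  case=> [/inw|/inw]; first by left.
  by rewrite (derive_oppr _ dF); right.
case=> c [dc c0 <- Ac]; rewrite -c0 in dF FB *.
have [dFc DFc] := derive_comp dc dF.
exists (F \o c); split=> //.
have FBc := near_curve dc FB.
by near=> h; have Ach : A (c h); [near: h|move: Ach; near: h].
Unshelve. all: by end_near. Qed.

(** One of the segments from [u] in the directions [w] and [- w] stays in the
    half-plane. *)
Lemma half_plane_velocity_line (R : realType) (V : set 'rV[R]_2)
    (u w : 'rV[R]_2) :
  open V -> (V `&` half_plane R) u ->
  velocity_line (V `&` half_plane R) u w.
Proof.
move=> oV [Vu Hu].
suff inw (z : 'rV[R]_2) : 0 <= z 0 1 -> inward_velocity (V `&` half_plane R) u z.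
  have [w0|w0] := leP 0 (w 0 1); [left|right]; apply: inw => //.
  by rewrite mxE oppr_ge0 ltW.
move=> z0.
pose c (h : R) := u + h *: z.
have c0 : c 0 = u by rewrite /c scale0r addr0.
have dc : is_diff (0 : R) c (fun h => 0 + h *: z) by exact: is_diffD.
exists c; split=> //; first by rewrite deriveE // diff_val add0r scale1r.
have Vc : \forall h \near 0^'+, V (c h).
  by apply: near_curve => //; rewrite c0; exact: open_nbhs_nbhs.
near=> h; split; first by near: h.
by rewrite /half_plane /= !mxE addr_ge0 // mulr_ge0 // ltW.
Unshelve. all: by end_near. Qed.

(** * Derivatives of maps defined on a set *)

Lemma C1_near_differentiable (R : realType) (m n : nat)
    (F : 'rV[R]_m -> 'rV[R]_n) (p : 'rV[R]_m) :
  C1_near F p -> differentiable F p.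
Proof. by move=> /nbhs_singleton[]. Qed.

Lemma C1_extension_at (R : realType) (m n : nat) (A : set 'rV[R]_m)
    (f F : 'rV[R]_m -> 'rV[R]_n) (p : 'rV[R]_m) :
  C1_extension A f p F -> A p -> F p = f p.
Proof. by move=> [_ /nbhs_singleton]. Qed.

(** Any C^1 extension computes the derivative, whichever one the choice
    operator picks. *)
Lemma dder_extension (R : realType) (m n : nat) (A : set 'rV[R]_m)
    (f F : 'rV[R]_m -> 'rV[R]_n) (p v : 'rV[R]_m) :
  C1_extension A f p F -> A p -> velocity_line A p v ->
  dder A f p v = 'D_v F p.
Proof.
move=> eF Ap Av; rewrite /dder; set G := get _.
have [dG GE] : C1_extension A f p G.
  exact: (getPex (ex_intro [set F | C1_extension A f p F] F eF)).
have [dF FE] := eF.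
apply: (velocity_line_derive_eq _ _ Ap _ Av); try exact: C1_near_differentiable.
by near=> x => Ax; rewrite (near GE x) // (near FE x).
Unshelve. all: by end_near. Qed.

Lemma tangent_velocity_line (R : realType) (S : set 'rV[R]_3)
    (p v : 'rV[R]_3) :
  tangent S p v -> velocity_line S p v.
Proof.
case=> V [W [phi [psi [u [w [ch VHu <- ->]]]]]].
have [F eF] := chart_C1 ch VHu.
have Hw := half_plane_velocity_line w (chart_open_dom ch) VHu.
rewrite (dder_extension eF) // -(C1_extension_at eF) //.
have [dF FE] := eF.
apply: (velocity_line_image _ _ Hw); first exact: C1_near_differentiable.
near=> x => VHx; rewrite (near FE x) //.
have : (S `&` W) (phi x) by rewrite -(chart_img ch); exists x.
by case.
Unshelve. all: by end_near. Qed.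

(** If F and G extend a chart and its inverse, then F \o G is the identity on the
    surface near [p], so that the differential of F maps the vector of chart
    coordinates 'D_v G p back to [v]. *)
Lemma velocity_line_tangent (R : realType) (S : set 'rV[R]_3)
    (p v : 'rV[R]_3) :
  C1_surface S -> S p -> velocity_line S p v -> tangent S p v.
Proof.
move=> hS Sp Sv; have [V [W [phi [psi [ch Wp]]]]] := hS p Sp.
have chI x : S x -> W x -> (V `&` half_plane R) (psi x) /\ phi (psi x) = x.
  move=> Sx Wx; have : (S `&` W) x by [].
  by rewrite -(chart_img ch) => -[u VHu <-]; rewrite (chart_cancel ch).
have [VHp phip] := chI _ Sp Wp.
have [G eG] := chart_inv_C1 ch (conj Sp Wp).
have [F eF] := chart_C1 ch VHp.
exists V, W, phi, psi, (psi p), ('D_v G p); split=> //.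
rewrite (dder_extension eF) //; last first.
  exact: (half_plane_velocity_line _ (chart_open_dom ch)).
have [C1F FE] := eF; have [C1G GE] := eG.
have dF := C1_near_differentiable C1F; have dG := C1_near_differentiable C1G.
have Gp : G p = psi p by exact: (C1_extension_at eG).
rewrite -Gp in dF FE *.
have dFG : differentiable (F \o G) p by exact: differentiable_comp.
transitivity ('D_v (F \o G) p); last first.
  by rewrite (deriveE _ dFG) (diff_comp dG dF) (deriveE _ dF) (deriveE _ dG).
rewrite -[LHS](@derive_id R _ p v).
apply: (velocity_line_derive_eq _ _ Sp _ Sv) => //.
have Wx : \forall x \near p, W x.
  exact: (open_nbhs_nbhs (conj (chart_open_img ch) Wp)).
have FEG := near_diff_image dG FE.
near=> x => Sx.
have Wx' : W x by near: x.
have [VHx phix] := chI x Sx Wx'.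
have Gx : G x = psi x by rewrite (near GE x).
have : (V `&` half_plane R) (G x) -> F (G x) = phi (G x) by near: x.
by rewrite /= Gx => ->.
Unshelve. all: by end_near. Qed.

Lemma dder_velocity_line (R : realType) (m n : nat) (A : set 'rV[R]_m)
    (B : set 'rV[R]_n) (f : 'rV[R]_m -> 'rV[R]_n) (p v : 'rV[R]_m) :
  C1_on A f -> (forall x, A x -> B (f x)) -> A p -> velocity_line A p v ->
  velocity_line B (f p) (dder A f p v).
Proof.
move=> C1f fAB Ap Av; have [F eF] := C1f p Ap.
rewrite (dder_extension eF) // -(C1_extension_at eF) //.
have [dF FE] := eF.
apply: (velocity_line_image _ _ Av); first exact: C1_near_differentiable.
by near=> x => Ax; rewrite (near FE x) //; exact: fAB.
Unshelve. all: by end_near. Qed.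

(** The composition of the extensions agrees with any extension of the
    composition on [A] only, hence the need for [velocity_line_derive_eq]. *)
Lemma dder_comp (R : realType) (m n k : nat) (A : set 'rV[R]_m)
    (B : set 'rV[R]_n) (f : 'rV[R]_m -> 'rV[R]_n) (g : 'rV[R]_n -> 'rV[R]_k)
    (p v : 'rV[R]_m) :
  C1_on A f -> C1_on B g -> C1_on A (g \o f) -> (forall x, A x -> B (f x)) ->
  A p -> velocity_line A p v ->
  dder A (g \o f) p v = dder B g (f p) (dder A f p v).
Proof.
move=> C1f C1g C1gf fAB Ap Av.
have Bv := dder_velocity_line C1f fAB Ap Av.
have [F eF] := C1f p Ap; have [G eG] := C1g _ (fAB _ Ap).
have [H eH] := C1gf p Ap.
rewrite (dder_extension eG) //; last exact: fAB.
rewrite (dder_extension eH) // (dder_extension eF) //.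
have Fp := C1_extension_at eF Ap.
have [C1F FE] := eF; have [C1G GE] := eG; have [C1H HE] := eH.
have dF := C1_near_differentiable C1F; have dG := C1_near_differentiable C1G.
have dH := C1_near_differentiable C1H.
rewrite -Fp in dG GE *.
have dGF : differentiable (G \o F) p by exact: differentiable_comp.
transitivity ('D_v (G \o F) p); last first.
  by rewrite (deriveE _ dGF) (diff_comp dF dG) (deriveE _ dG) (deriveE _ dF).
apply: (velocity_line_derive_eq _ _ Ap _ Av) => //.
have GEF := near_diff_image dF GE.
near=> x => Ax; rewrite (near HE x) //=.
have Fx : F x = f x by rewrite (near FE x).
have : B (F x) -> G (F x) = g (F x) by near: x.
by rewrite Fx => -> //; exact: fAB.
Unshelve. all: by end_near. Qed.

Lemma dder_id (R : realType) (n : nat) (A : set 'rV[R]_n)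
    (f : 'rV[R]_n -> 'rV[R]_n) (p v : 'rV[R]_n) :
  C1_on A f -> (forall x, A x -> f x = x) -> A p -> velocity_line A p v ->
  dder A f p v = v.
Proof.
move=> C1f fid Ap Av; have [F eF] := C1f p Ap.
rewrite (dder_extension eF) //; have [C1F FE] := eF.
rewrite -[RHS](@derive_id R _ p v).
apply: (velocity_line_derive_eq _ _ Ap _ Av) => //.
  exact: C1_near_differentiable.
by near=> x => Ax; rewrite (near FE x) // fid.
Unshelve. all: by end_near. Qed.

Lemma jacobian_subid (R : realType) (n : nat)
    (F : 'rV[R]_n -> 'rV[R]_n) (y : 'rV[R]_n) :
  differentiable F y ->
  jacobian (F \- id) y = jacobian F y - 1%:M.
Proof.
move=> dF.
have E v : 'd (F \- id) y v = 'd F y v - v.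
  have dFid : is_diff y (F - id) (('d F y : 'rV[R]_n -> 'rV[R]_n) - id).
    by apply: is_diffB; exact/differentiableP.
  by have /(congr1 (@^~ v)) := @diff_val _ _ _ _ _ _ _ dFid.
have JE (G : 'rV[R]_n -> 'rV[R]_n) i j :
    jacobian G y i j = ('d G y (delta_mx 0 i)) 0 j by rewrite /jacobian mxE.
have subE (M N : 'M[R]_n) i j : (M - N) i j = M i j - N i j by rewrite !mxE.
have subE1 (v w : 'rV[R]_n) j : (v - w) 0 j = v 0 j - w 0 j by rewrite !mxE.
have deltaE i j : (delta_mx 0 i : 'rV[R]_n) 0 j = 1%:M i j.
  by rewrite !mxE eqxx eq_sym.
apply/matrixP => i j.
(* Each rewriting is applied at a given place, since searching for a
   differential in the goal unfolds it. *)
apply: (etrans (JE _ i j)).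
apply: (etrans (congr1 (fun z : 'rV[R]_n => z 0 j) (E _))).
apply: (etrans (subE1 _ _ _)).
apply: esym; apply: (etrans (subE _ _ _ _)).
exact: (f_equal2 (fun a b => a - b) (JE F i j) (esym (deltaE i j))).
Qed.

(** An extension of [f] minus the identity is an extension of [f \- id]; the
    point is that it is again C^1. *)
Lemma C1_near_subid (R : realType) (n : nat) (F : 'rV[R]_n -> 'rV[R]_n)
    (p : 'rV[R]_n) :
  C1_near F p -> C1_near (F \- id) p.
Proof.
move=> /near_join C1F; near=> x.
have C1x : C1_near F x by near: x.
have [dF cF] := nbhs_singleton C1x.
split; first exact: differentiableB.
have cJ : {for x, continuous (fun y => jacobian F y - 1%:M)}.
  by apply: continuousB; [exact: cF|exact: cst_continuous].
rewrite /prop_for /continuous_at (jacobian_subid dF).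
have JE : \forall y \near x, jacobian F y - 1%:M = jacobian (F \- id) y.
  by apply: filterS C1x => y [dFy _]; exact/esym/jacobian_subid.
exact: cvg_trans (near_eq_cvg JE) cJ.
Unshelve. all: by end_near. Qed.

Lemma dder_subid (R : realType) (n : nat) (A : set 'rV[R]_n)
    (f : 'rV[R]_n -> 'rV[R]_n) (p v : 'rV[R]_n) :
  C1_on A f -> A p -> velocity_line A p v ->
  dder A (f \- id) p v = dder A f p v - v.
Proof.
move=> C1f Ap Av; have [F eF] := C1f p Ap; have [C1F FE] := eF.
have eFid : C1_extension A (f \- id) p (F \- id).
  split; first exact: C1_near_subid.
  by near=> x => Ax /=; rewrite (near FE x).
rewrite (dder_extension eF) // (dder_extension eFid) //.
have dF := C1_near_differentiable C1F.
by rewrite deriveB ?derive_id //; exact: diff_derivable.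
Unshelve. all: by end_near. Qed.

(** All three derivatives are those of the same chosen extension. *)
Lemma dder_lin (R : realType) (m n : nat) (A : set 'rV[R]_m)
    (f : 'rV[R]_m -> 'rV[R]_n) (p v w : 'rV[R]_m) (a b : R) :
  C1_on A f -> A p ->
  dder A f p (a *: v + b *: w) = a *: dder A f p v + b *: dder A f p w.
Proof.
move=> C1f Ap; have [F eF] := C1f p Ap; rewrite /dder; set G := get _.
have [C1G _] : C1_extension A f p G.
  exact: (getPex (ex_intro [set F | C1_extension A f p F] F eF)).
have dG := C1_near_differentiable C1G.
by rewrite !(deriveE _ dG) linearD !linearZ.
Qed.

(** * Euclidean algebra *)

Lemma dotrC (R : realType) (n : nat) (a b : 'rV[R]_n) : dotr a b = dotr b a.
Proof. by apply: eq_bigr => i _; rewrite mulrC. Qed.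

Lemma frob_outer (R : realType) (n : nat) (a b c d : 'rV[R]_n) :
  frob (outer a b) (outer c d) = dotr a c * dotr b d.
Proof.
rewrite /frob /dotr big_distrl /=; apply: eq_bigr => i _.
by rewrite big_distrr /=; apply: eq_bigr => j _; rewrite !mxE mulrACA.
Qed.

Lemma frobDl (R : realType) (n : nat) (A B C : 'M[R]_n) :
  frob (A + B) C = frob A C + frob B C.
Proof.
rewrite /frob -big_split; apply: eq_bigr => i _ /=.
by rewrite -big_split; apply: eq_bigr => j _ /=; rewrite mxE mulrDl.
Qed.

Lemma frobDr (R : realType) (n : nat) (A B C : 'M[R]_n) :
  frob A (B + C) = frob A B + frob A C.
Proof.
rewrite /frob -big_split; apply: eq_bigr => i _ /=.
by rewrite -big_split; apply: eq_bigr => j _ /=; rewrite mxE mulrDr.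
Qed.

Lemma frob_onb (R : realType) (n : nat) (x1 x2 z1 z2 t1 t2 : 'rV[R]_n) :
  dotr t1 t1 = 1 -> dotr t2 t2 = 1 -> dotr t1 t2 = 0 ->
  frob (outer x1 t1 + outer x2 t2) (outer z1 t1 + outer z2 t2) =
  dotr x1 z1 + dotr x2 z2.
Proof.
move=> t11 t22 t12; rewrite frobDl !frobDr !frob_outer t11 t22.
by rewrite (dotrC t2) t12 !mulr0 !mulr1 addr0 add0r.
Qed.

Lemma dotrE (R : realType) (a b : 'rV[R]_3) :
  dotr a b = a 0 0 * b 0 0 + a 0 1 * b 0 1 + a 0 2%:R * b 0 2%:R.
Proof.
have e1 : lift ord0 ord0 = 1 :> 'I_3 by exact: val_inj.
have e2 : lift ord0 (lift ord0 ord0) = 2%:R :> 'I_3 by exact: val_inj.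
by rewrite /dotr !big_ord_recl big_ord0 addr0 addrA e1 e2.
Qed.

Lemma crossE (R : realType) (a b : 'rV[R]_3) :
  [/\ cross a b 0 0 = a 0 1 * b 0 2%:R - a 0 2%:R * b 0 1,
      cross a b 0 1 = a 0 2%:R * b 0 0 - a 0 0 * b 0 2%:R
    & cross a b 0 2%:R = a 0 0 * b 0 1 - a 0 1 * b 0 0].
Proof.
by split; rewrite mxE; congr (a _ _ * b _ _ - a _ _ * b _ _); exact: val_inj.
Qed.

(** Lagrange's identity. *)
Lemma dotr_cross (R : realType) (a b : 'rV[R]_3) :
  dotr (cross a b) (cross a b) = dotr a a * dotr b b - dotr a b ^+ 2.
Proof. by have [c0 c1 c2] := crossE a b; rewrite !dotrE c0 c1 c2; ring. Qed.

Lemma cross_lin2 (R : realType) (u v : 'rV[R]_3) (a b c d : R) :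
  cross (a *: u + b *: v) (c *: u + d *: v) = (a * d - b * c) *: cross u v.
Proof. by apply/rowP => i; rewrite !mxE; ring. Qed.

Lemma dotr_ge0 (R : realType) (n : nat) (a : 'rV[R]_n) : 0 <= dotr a a.
Proof. by apply: sumr_ge0 => i _; rewrite -expr2 sqr_ge0. Qed.

Lemma enormZ (R : realType) (n : nat) (k : R) (a : 'rV[R]_n) :
  enorm (k *: a) = `|k| * enorm a.
Proof.
rewrite /enorm; have -> : dotr (k *: a) (k *: a) = k ^+ 2 * dotr a a.
  by rewrite /dotr big_distrr /=; apply: eq_bigr => i _; rewrite !mxE; ring.
by rewrite sqrtrM ?sqr_ge0 // sqrtr_sqr.
Qed.

(** [D] is the determinant of the coordinates of [a] and [b] on [u] and [v].
    It does not depend on [L], so that the same factor serves for the surface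
    element of Y, with [L] the identity, and for that of X \o Y, with [L] the
    differential of X. *)
Lemma enorm_cross_comb (R : realType) (u v a b : 'rV[R]_3) :
  (exists x y, a = x *: u + y *: v) -> (exists x y, b = x *: u + y *: v) ->
  exists D : R, forall L : 'rV[R]_3 -> 'rV[R]_3,
    (forall x y, L (x *: u + y *: v) = x *: L u + y *: L v) ->
    enorm (cross (L a) (L b)) = `|D| * enorm (cross (L u) (L v)).
Proof.
move=> [x [y ->]] [z [w ->]]; exists (x * w - y * z) => L linL.
by rewrite !linL cross_lin2 enormZ.
Qed.

Lemma enorm_cross_onb (R : realType) (a b : 'rV[R]_3) :
  dotr a a = 1 -> dotr b b = 1 -> dotr a b = 0 -> enorm (cross a b) = 1.
Proof.
by move=> aa bb ab; rewrite /enorm dotr_cross aa bb ab expr0n mulr1 subr0 sqrtr1.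
Qed.

(** Half of the expansion of 0 <= |a - t|^2. *)
Lemma dotr_sub_ge (R : realType) (n : nat) (a t : 'rV[R]_n) :
  dotr t t = 1 -> (dotr a a - 1) / 2 <= dotr a (a - t).
Proof.
move=> tt; have := dotr_ge0 (a - t).
have dBr (x y z : 'rV[R]_n) : dotr x (y - z) = dotr x y - dotr x z.
  by rewrite /dotr -sumrB; apply: eq_bigr => i _; rewrite !mxE mulrBr.
by rewrite (dBr (a - t)) !(dotrC (a - t)) !dBr tt (dotrC t a); lra.
Qed.

(** By Lagrange's identity the norm of the cross product is at most the product
    of the norms, hence at most the mean of their squares. *)
Lemma enorm_cross_le (R : realType) (a b : 'rV[R]_3) :
  enorm (cross a b) <= (dotr a a + dotr b b) / 2.
Proof.
have a0 := dotr_ge0 a; have b0 := dotr_ge0 b.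
have m0 : 0 <= (dotr a a + dotr b b) / 2 by lra.
rewrite -(ger0_norm m0) -sqrtr_sqr /enorm ler_wsqrtr // dotr_cross.
have := sqr_ge0 (dotr a b); have := sqr_ge0 (dotr a a - dotr b b); nra.
Qed.

Lemma area_energy_le (R : realType) (x1 x2 t1 t2 : 'rV[R]_3) :
  dotr t1 t1 = 1 -> dotr t2 t2 = 1 ->
  enorm (cross x1 x2) - 1 <= dotr x1 (x1 - t1) + dotr x2 (x2 - t2).
Proof.
move=> t11 t22; have hJ := enorm_cross_le x1 x2.
have h1 := dotr_sub_ge x1 t11; have h2 := dotr_sub_ge x2 t22.
lra.
Qed.

Unset Implicit Arguments.

(** * Surface elements and surface gradients *)

Theorem lemma3p1 (R : realType)
    (sigma0 sigma sigma1 : set 'rV[R]_3)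
    (Y X : 'rV[R]_3 -> 'rV[R]_3)
    (hsigma0 : C1_surface sigma0)
    (hsigma : C1_surface sigma)
    (hsigma1 : C1_surface sigma1)
    (hY : parametrizes sigma0 sigma Y)
    (hX : C1_on sigma X)
    (hXY : parametrizes sigma0 sigma1 (X \o Y))
    (p : 'rV[R]_3) (hp : sigma0 p)
    (s1 s2 : 'rV[R]_3) (hs : onb_tangent sigma0 p s1 s2)
    (t1 t2 : 'rV[R]_3) (ht : onb_tangent sigma (Y p) t1 t2) :
  let lhs :=
    frob (surf_grad sigma X t1 t2 (Y p))
         (surf_grad sigma (X \- id) t1 t2 (Y p))
    * surf_elt sigma0 Y s1 s2 p in
  let rhs :=
    surf_elt sigma0 (X \o Y) s1 s2 p - surf_elt sigma0 Y s1 s2 p in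
  lhs >= rhs /\ ((forall y, sigma y -> X y = y) -> lhs = rhs).
Proof.
have [C1Y imY] := hY; have [C1XY _] := hXY.
have YS x : sigma0 x -> sigma (Y x) by move=> Sx; rewrite -imY; exists x.
have Sy := YS _ hp.
have [_ _ _ Ts] := hs; have [t11 t22 t12 Tt] := ht.
have Ts1 : velocity_line sigma0 p s1.
  apply: tangent_velocity_line; rewrite Ts.
  by exists 1, 0; rewrite scale1r scale0r addr0.
have Ts2 : velocity_line sigma0 p s2.
  apply: tangent_velocity_line; rewrite Ts.
  by exists 0, 1; rewrite scale1r scale0r add0r.
have Tt1 : velocity_line sigma (Y p) t1.
  apply: tangent_velocity_line; rewrite Tt.
  by exists 1, 0; rewrite scale1r scale0r addr0.
have Tt2 : velocity_line sigma (Y p) t2.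
  apply: tangent_velocity_line; rewrite Tt.
  by exists 0, 1; rewrite scale1r scale0r add0r.
have comb s : velocity_line sigma0 p s ->
    exists x y, dder sigma0 Y p s = x *: t1 + y *: t2.
  move=> Ts'; suff : tangent sigma (Y p) (dder sigma0 Y p s) by rewrite Tt.
  exact/velocity_line_tangent/dder_velocity_line.
have [D HD] := enorm_cross_comb (comb _ Ts1) (comb _ Ts2).
have JY : surf_elt sigma0 Y s1 s2 p = `|D|.
  by rewrite /surf_elt (HD id) // enorm_cross_onb // mulr1.
have JXY : surf_elt sigma0 (X \o Y) s1 s2 p =
    `|D| * enorm (cross (dder sigma X (Y p) t1) (dder sigma X (Y p) t2)).
  rewrite /surf_elt !(dder_comp C1Y hX C1XY YS hp) //.
  by apply: (HD (dder sigma X (Y p))) => x y; exact: dder_lin.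
rewrite /= frob_onb // !(dder_subid hX Sy) // JXY JY.
split.
  rewrite -[Z in _ - Z <= _]mulr1 -mulrBr mulrC.
  by apply: ler_wpM2r => //; exact: area_energy_le.
move=> Xid; rewrite !(dder_id hX Xid Sy) // enorm_cross_onb // mulr1 !subrr.
by rewrite /dotr big1 ?big1 ?addr0 ?mul0r // => i _; rewrite mxE mulr0.
Qed.
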